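(* There exist absolute constants $c_1, c_2 > 0$ such that the following holds. For every function $f:\{\pm1\}^n\to\{\pm1\}$, every distribution $\mu$ over $\{\pm1\}^n$, every $k\in\mathbb{N}$, and every $\gamma,\delta\in(0,1)$, \[ \overline{\mathrm{Depth}}^{\mu^k}\!\left(f^{\oplus k},\,\tfrac12\big(1-e^{-c_1\delta k}-\gamma\big)\right)\;\ge\; c_2\,\frac{\gamma^2 k}{\log(1/\delta)}\cdot \overline{\mathrm{Depth}}^{\mu}(f,\delta). \]
   Context: A deterministic decision tree on $\{\pm1\}^N$ queries input coordinates adaptively and outputs a label at the leaf reached; a randomized decision tree is a probability distribution over deterministic decision trees. For a distribution $\mu$ over inputs, the expected depth of a deterministic tree is the expected number of coordinates queried on $\mathbf{x}\sim\mu$; for a randomized tree it is the average of this over its random choice. For a function $g$ and $\varepsilon\in[0,1]$, $\overline{\mathrm{Depth}}^{\mu}(g,\varepsilon)$ is the minimum expected depth (w.r.t. $\mu$) of any randomized decision tree $\mathcal T$ with $\Pr_{\mathbf x\sim\mu}[\mathcal T(\mathbf x)\neq g(\mathbf x)]\le\varepsilon$. $\mu^k$ is the $k$-fold product distribution on $(\{\pm1\}^n)^k$, and $f^{\oplus k}:(\{\pm1\}^n)^k\to\{\pm1\}$ is $f^{\oplus k}(X^{(1)},\dots,X^{(k)})=\prod_{i=1}^k f(X^{(i)})$ (the XOR of the $k$ values in $\pm1$ notation). *)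

(* Defs.v *)
From HB Require Import structures.
From mathcomp Require Import all_boot all_order all_algebra.
From mathcomp Require Import all_classical all_reals all_analysis.

Set Implicit Arguments.
Unset Strict Implicit.
Unset Printing Implicit Defensive.

Import Order.TTheory GRing.Theory Num.Theory.

Local Open Scope classical_set_scope.
Local Open Scope ring_scope.

(* The group {1, -1} is represented by [bool] through [b |-> (-1) ^+ b], so
   that the product of signs becomes [addb]; see [signr_xor_power]. *)
Notation cube I := {ffun I -> bool}.

Inductive dtree (I : Type) : Type :=
| Leaf of bool
| Query of I & dtree I & dtree I.

Arguments Leaf {I}.

(* [Query i t0 t1] continues with [t1] if the i-th bit is [true] (the
   coordinate is -1) and with [t0] otherwise. *)
Fixpoint dtree_eval (I : finType) (t : dtree I) (x : cube I) : bool :=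
  match t with
  | Leaf b => b
  | Query i t0 t1 => if x i then dtree_eval t1 x else dtree_eval t0 x
  end.

Fixpoint dtree_queries (I : finType) (t : dtree I) (x : cube I) : nat :=
  match t with
  | Leaf _ => 0
  | Query i t0 t1 =>
      (if x i then dtree_queries t1 x else dtree_queries t0 x).+1
  end.

Fixpoint dtree_encode (I : Type) (t : dtree I) : GenTree.tree (I + bool) :=
  match t with
  | Leaf b => GenTree.Leaf (inr b)
  | Query i t0 t1 =>
      GenTree.Node 0 [:: GenTree.Leaf (inl i); dtree_encode t0; dtree_encode t1]
  end.

Fixpoint dtree_decode (I : Type) (s : GenTree.tree (I + bool)) :
    option (dtree I) :=
  match s with
  | GenTree.Leaf (inr b) => Some (Leaf b)
  | GenTree.Node _ [:: GenTree.Leaf (inl i); s0; s1] =>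
      match dtree_decode s0, dtree_decode s1 with
      | Some t0, Some t1 => Some (Query i t0 t1)
      | _, _ => None
      end
  | _ => None
  end.

Lemma dtree_encodeK (I : Type) : pcancel (@dtree_encode I) (@dtree_decode I).
Proof. by elim=> [b|i t0 IH0 t1 IH1] //=; rewrite IH0 IH1. Qed.

HB.instance Definition _ (I : finType) :=
  Countable.copy (dtree I) (pcan_type (@dtree_encodeK I)).
HB.instance Definition _ (I : finType) :=
  isPointed.Build (dtree I) (Leaf false).
HB.instance Definition _ (I : finType) :=
  @isMeasurable.Build default_measure_display (dtree I)
    discrete_measurable discrete_measurable0
    discrete_measurableC discrete_measurableU.

Section Depth.
Variables (R : realType) (I : finType).
Implicit Types (mu : cube I -> R) (g : cube I -> bool).
Implicit Types (t : dtree I) (P : probability (dtree I) R).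

Definition tree_depth mu t : R := \sum_x mu x * (dtree_queries t x)%:R.

Definition tree_error mu g t : R := \sum_(x | dtree_eval t x != g x) mu x.

(* A randomized tree is a probability measure on the countable, discrete space
   of deterministic trees. *)
Definition rand_depth mu P : \bar R := 'E_P[tree_depth mu].

Definition rand_error mu g P : \bar R := 'E_P[tree_error mu g].

(* For eps < 0 no tree qualifies and the value is +oo. *)
Definition avg_depth mu g (eps : R) : \bar R :=
  ereal_inf [set rand_depth mu P |
             P in [set P | (rand_error mu g P <= eps%:E)%E]].

End Depth.

Definition is_distribution (R : realType) (T : finType) (mu : T -> R) : Prop :=
  (forall x, 0 <= mu x) /\ \sum_x mu x = 1.

Section Powers.
Variables (n k : nat).

(* ({1, -1}^n)^k is flattened to a cube over the pairs (i, j), which are the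
   coordinates that a tree may query. *)
Definition block (X : cube ('I_k * 'I_n)%type) (i : 'I_k) : cube 'I_n :=
  [ffun j => X (i, j)].

Definition power_distribution (R : realType) (mu : cube 'I_n -> R)
    (X : cube ('I_k * 'I_n)%type) : R :=
  \prod_(i < k) mu (block X i).

Definition xor_power (f : cube 'I_n -> bool) (X : cube ('I_k * 'I_n)%type) :
    bool :=
  \big[addb/false]_(i < k) f (block X i).

Lemma signr_xor_power (R : realType) (f : cube 'I_n -> bool)
    (X : cube ('I_k * 'I_n)%type) :
  (-1) ^+ xor_power f X = \prod_(i < k) (-1) ^+ f (block X i) :> R.
Proof.
rewrite /xor_power; elim/big_rec2: _ => [|i s b _ <-]; first by rewrite expr0.
by rewrite signr_addb.
Qed.

Lemma power_distribution_is_distribution (R : realType) (mu : cube 'I_n -> R) :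
  is_distribution mu -> is_distribution (power_distribution mu).
Proof.
move=> [mu_ge0 mu1]; split=> [X|]; first by apply: prodr_ge0 => i _.
pose flat (Y : {ffun 'I_k -> cube 'I_n}) : cube ('I_k * 'I_n)%type :=
  [ffun p => Y p.1 p.2].
rewrite (reindex flat) /=; last first.
  exists (fun X => [ffun i => block X i]) => X _; apply/ffunP => p.
    by rewrite ffunE; apply/ffunP => j; rewrite !ffunE.
  by rewrite !ffunE; case: p.
under eq_bigr => Y _.
  rewrite /power_distribution.
  under eq_bigr => i _.
    rewrite (_ : block (flat Y) i = Y i); last by apply/ffunP => j; rewrite !ffunE.
    over.
  over.
by rewrite -(bigA_distr_bigA (fun=> mu)) big1.
Qed.

End Powers.

(* Main.v *)
Require Import Defs.
From mathcomp Require Import all_boot all_order all_algebra.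
From mathcomp Require Import all_classical all_reals all_analysis.
From mathcomp Require Import ring lra zify.

Set Implicit Arguments.
Unset Strict Implicit.
Unset Printing Implicit Defensive.

Import Order.TTheory GRing.Theory Num.Theory.

Local Open Scope ring_scope.

(* Fix H : cube -> [0, 1] and a tree T for the XOR.  Conditioned on a leaf of T
   the k blocks are independent, so the correlation of T at the leaf is a
   product over the blocks; the excess over the value it would have if T knew
   nothing on H is controlled by the leaf norms, against the weight mu H f, of
   the single-block trees obtained from T by fixing the other blocks.  Averaging
   a good randomized T yields one fixed distribution over single-block trees
   whose mean leaf norm B satisfies B(H) >= (gamma / 8) E[H] as soon as
   E[H] >= delta / 2; H only influences the labels of the leaves.
   Since B is sublinear, no minimax argument is needed: if H has the largest
   number of ones among the H with B(H) <= (gamma / 16) E[H], then mu(H = 1) is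
   less than delta / 2 and every weight supported outside {H = 1} satisfies the
   reverse inequality.  Boosting on that support with
   O(log(1/delta) / gamma^2) trees, drawn so that error and depth are controlled
   by one potential, gives a majority vote with error at most delta. *)

(** * Correlation of a tree under optimal leaf labels *)

Section LeafNorm.
Variables (R : realType) (I : finType).
Implicit Types (t : dtree I) (g h : cube I -> R).

Definition halve (i : I) (b : bool) g : cube I -> R :=
  fun x => if x i == b then g x else 0.

(** The best correlation with [g] over all labellings of the leaves of [t], whose own labels are
    ignored; [relabel] attains it. *)
Fixpoint leaf_norm t g : R :=
  match t with
  | Leaf _ => `|\sum_x g x|
  | Query i t0 t1 =>
      leaf_norm t0 (halve i false g) + leaf_norm t1 (halve i true g)
  end.

Fixpoint relabel t g : dtree I :=
  match t with
  | Leaf _ => Leaf (\sum_x g x < 0)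
  | Query i t0 t1 =>
      Query i (relabel t0 (halve i false g)) (relabel t1 (halve i true g))
  end.

Lemma sum_halve i (g : cube I -> R) :
  \sum_x g x = \sum_x halve i false g x + \sum_x halve i true g x.
Proof.
rewrite -big_split; apply: eq_bigr => x _; rewrite /halve.
by case: (x i); rewrite /= ?addr0 ?add0r.
Qed.

Lemma leaf_normD t g h :
  leaf_norm t (fun x => g x + h x) <= leaf_norm t g + leaf_norm t h.
Proof.
elim: t g h => [b|i t0 IH0 t1 IH1] g h /=.
  by rewrite big_split; exact: ler_normD.
have halveD b : halve i b (fun x => g x + h x) =
    fun x => halve i b g x + halve i b h x.
  by apply: funext => x; rewrite /halve; case: ifP; rewrite ?addr0.
rewrite !halveD addrACA; exact: lerD.
Qed.

Lemma leaf_normZ t c g : 0 <= c ->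
  leaf_norm t (fun x => c * g x) = c * leaf_norm t g.
Proof.
move=> c0; elim: t g => [b|i t0 IH0 t1 IH1] g /=.
  by rewrite -mulr_sumr normrM ger0_norm.
have halveZ b : halve i b (fun x => c * g x) = fun x => c * halve i b g x.
  by apply: funext => x; rewrite /halve; case: ifP; rewrite ?mulr0.
by rewrite !halveZ IH0 IH1 mulrDr.
Qed.

Lemma relabel_correlation t g :
  \sum_x g x * (-1) ^+ dtree_eval (relabel t g) x = leaf_norm t g.
Proof.
elim: t g => [b|i t0 IH0 t1 IH1] g /=.
  rewrite -mulr_suml; case: ltP => h; first by rewrite mulrN1 ltr0_norm.
  by rewrite mulr1 ger0_norm.
rewrite -IH0 -IH1 -big_split; apply: eq_bigr => x _ /=.
by rewrite /halve; case: (x i) => /=; rewrite mul0r ?addr0 ?add0r.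
Qed.

Lemma relabel_queries t g x :
  dtree_queries (relabel t g) x = dtree_queries t x.
Proof. by elim: t g => [//|i t0 IH0 t1 IH1] g /=; rewrite IH0 IH1. Qed.

End LeafNorm.

Lemma normr_mul_sign (R : realDomainType) (x : R) (b : bool) :
  `|x * (-1) ^+ b| = `|x|.
Proof. by rewrite normrM normr_sign mulr1. Qed.

(** With [b i = a i / M i], each factor is at most [(1 + b i) * (M i - h i / 2)], because
    [h i * (1 - b i) >= 0]. If the [b i] add up to at most [s], the product is thus bounded by the
    first term. Otherwise the trivial bound [\prod_i M i] is below the second term, as in Markov's
    inequality. *)
Lemma prod_bound (R : realType) (k : nat) (M h a : 'I_k -> R) (s : R) :
  0 < s -> (forall i, 0 <= a i <= h i) -> (forall i, h i <= M i) ->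
  \prod_i (M i - h i + a i) <=
  expR s * \prod_i (M i - h i / 2) + s^-1 * \sum_i a i * \prod_(j | j != i) M j.
Proof.
move=> s0 ah hM.
have a0 i : 0 <= a i by case/andP: (ah i).
have h0 i : 0 <= h i by case/andP: (ah i); exact: le_trans.
have M0 i : 0 <= M i by exact: le_trans (hM i).
have Mh i : 0 <= M i - h i / 2 by move: (h0 i) (hM i); lra.
(* A block of mass zero would spoil the division by [M i]; there [h i = a i = 0] and the left-hand
   side vanishes. *)
have [/existsP[i /eqP Mi]|] := boolP [exists i, M i == 0].
  have hi : h i = 0 by apply/eqP; rewrite eq_le h0 -[X in _ <= X]Mi hM.
  have ai : a i = 0.
    by apply/eqP; rewrite eq_le a0 -[X in _ <= X]hi; case/andP: (ah i) => _ ->.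
  rewrite (bigD1 i) //= Mi hi ai subrr addr0 mul0r.
  apply: addr_ge0; first by rewrite mulr_ge0 ?expR_ge0 // prodr_ge0.
  rewrite mulr_ge0 ?invr_ge0 ?(ltW s0) // sumr_ge0 // => j _.
  by rewrite mulr_ge0 // prodr_ge0.
rewrite negb_exists => /forallP MN.
have Mp i : 0 < M i by rewrite lt_neqAle eq_sym MN M0.
pose b i := a i / M i.
have b0 i : 0 <= b i by rewrite divr_ge0.
have aE i : a i = b i * M i by rewrite /b divfK.
have b1 i : b i <= 1.
  by rewrite ler_pdivrMr // mul1r (le_trans _ (hM i)) //; case/andP: (ah i).
have sumE : \sum_i a i * \prod_(j | j != i) M j = (\sum_i b i) * \prod_i M i.
  rewrite mulr_suml; apply: eq_bigr => i _.
  by rewrite [in RHS](bigD1 i) //= mulrA -aE.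
have le1 : \prod_i (M i - h i + a i) <=
    expR (\sum_i b i) * \prod_i (M i - h i / 2).
  rewrite expR_sum -big_split /=; apply: ler_prod => i _; apply/andP; split.
    by move: (hM i) (a0 i); lra.
  apply: (@le_trans _ _ ((1 + b i) * (M i - h i / 2))).
    have : 0 <= h i * (1 - b i) by rewrite mulr_ge0 // subr_ge0.
    by rewrite aE; lra.
  by apply: ler_wpM2r => //; exact: expR_ge1Dx.
have [bs|sb] := leP (\sum_i b i) s.
  apply: (le_trans le1); rewrite -[X in X <= _]addr0; apply: lerD.
    by apply: ler_wpM2r; rewrite ?ler_expR // prodr_ge0.
  rewrite mulr_ge0 ?invr_ge0 ?(ltW s0) // sumr_ge0 // => j _.
  by rewrite mulr_ge0 // prodr_ge0.
rewrite -[X in X <= _]add0r; apply: lerD.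
  by rewrite mulr_ge0 ?expR_ge0 // prodr_ge0.
rewrite sumE mulrA.
apply: (@le_trans _ _ (\prod_i M i)).
  apply: ler_prod => i _; move: (ah i) (hM i) => /andP[? ?] ?.
  by apply/andP; split; lra.
apply: ler_peMl; first by rewrite prodr_ge0.
by rewrite mulrC ler_pdivlMr // mul1r ltW.
Qed.

(** * Product weights on the blocks and trees restricted to one block *)

Section Blocks.
Variables (R : realType) (n k : nat).
Notation state := ('I_k -> cube 'I_n -> R).
Implicit Types (m : state) (t : dtree ('I_k * 'I_n)%type).
Implicit Types (X z : cube ('I_k * 'I_n)%type) (g : cube 'I_n -> R).

Definition pweight m X : R := \prod_i m i (block X i).

Definition update m (i : 'I_k) g : state := fun j => if j == i then g else m j.

(** An answer cuts the weight of one block only, so the inputs that reach a node always carry a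
    product weight. Inductions on trees therefore run over all states [m]. *)
Definition branch m (p : 'I_k * 'I_n) (b : bool) : state :=
  update m p.1 (halve p.2 b (m p.1)).

(** Block [i] of [z] is never read, so [z] may be a full input; weighting that block by the
    normalised [mu] makes it contribute a factor 1. *)
Fixpoint restrict (i : 'I_k) z t : dtree 'I_n :=
  match t with
  | Leaf b => Leaf b
  | Query p t0 t1 =>
      if p.1 == i then Query p.2 (restrict i z t0) (restrict i z t1)
      else if z p then restrict i z t1 else restrict i z t0
  end.

Lemma sum_pweight m : \sum_X pweight m X = \prod_i \sum_x m i x.
Proof.
pose flat (Y : {ffun 'I_k -> cube 'I_n}) : cube ('I_k * 'I_n)%type :=
  [ffun p => Y p.1 p.2].
rewrite (reindex flat) /=; last first.
  exists (fun X => [ffun i => block X i]) => X _; apply/ffunP => p.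
    by rewrite ffunE; apply/ffunP => j; rewrite !ffunE.
  by rewrite !ffunE; case: p.
rewrite (bigA_distr_bigA m) /=; apply: eq_bigr => Y _.
apply: eq_bigr => i _; congr (m i _).
by apply/ffunP => j; rewrite !ffunE.
Qed.

Lemma pweight_branch m p b X :
  pweight (branch m p b) X = if X p == b then pweight m X else 0.
Proof.
rewrite /pweight (bigD1 p.1) //= /branch /update /halve eqxx ffunE.
rewrite -surjective_pairing.
case: ifP => _; last by rewrite mul0r.
rewrite [in RHS](bigD1 p.1) //=; congr (_ * _).
by apply: eq_bigr => i /negbTE ->.
Qed.

Lemma sum_branch m p (F : _ -> R) :
  \sum_X pweight m X * F X =
  \sum_X pweight (branch m p false) X * F X +
  \sum_X pweight (branch m p true) X * F X.
Proof.
rewrite -big_split; apply: eq_bigr => X _; rewrite !pweight_branch.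
by case: (X p); rewrite /= mul0r ?addr0 ?add0r.
Qed.

Lemma branch_ge0 m p b :
  (forall i x, 0 <= m i x) -> forall i x, 0 <= branch m p b i x.
Proof.
by move=> m0 i x; rewrite /branch /update /halve; case: ifP => // _; case: ifP.
Qed.

Lemma update_branch m p b g :
  update (branch m p b) p.1 g = update m p.1 g.
Proof.
by apply: funext => i; rewrite /update /branch /update; case: (i == p.1).
Qed.

Lemma update_branchC m p b i g : p.1 != i ->
  update (branch m p b) i g = branch (update m i g) p b.
Proof.
move=> pi; apply: funext => j; rewrite /branch /update (negbTE pi).
by case: eqP => [->|//]; rewrite eq_sym (negbTE pi).
Qed.

Lemma branch_neq m p b i : p.1 != i -> branch m p b i = m i.
Proof. by rewrite /branch /update eq_sym => /negbTE ->. Qed.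

Lemma branch_eq m p b : branch m p b p.1 = halve p.2 b (m p.1).
Proof. by rewrite /branch /update eqxx. Qed.

Variable mu : cube 'I_n -> R.
Hypothesis mu1 : \sum_x mu x = 1.

Lemma sum_pweight_update m i g :
  \sum_X pweight (update m i g) X =
  (\sum_x g x) * \prod_(j | j != i) \sum_x m j x.
Proof.
rewrite sum_pweight (bigD1 i) //= {1}/update eqxx; congr (_ * _).
by apply: eq_bigr => j /negbTE ji; rewrite /update ji.
Qed.

Lemma branch_prod m p (F : 'I_k -> cube 'I_n -> R) :
  \prod_i \sum_x m i x * F i x =
  \prod_i (\sum_x branch m p false i x * F i x) +
  \prod_i (\sum_x branch m p true i x * F i x).
Proof.
rewrite ![in RHS](bigD1 p.1 (P := predT)) //=.
rewrite ![in LHS](bigD1 p.1 (P := predT)) //=.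
have E b : \prod_(i | i != p.1) (\sum_x branch m p b i x * F i x) =
    \prod_(i | i != p.1) (\sum_x m i x * F i x).
  by apply: eq_bigr => i ip; rewrite branch_neq // eq_sym.
rewrite !E -mulrDl; congr (_ * _); rewrite !branch_eq (sum_halve p.2).
by congr (_ + _); apply: eq_bigr => x _; rewrite /halve; case: ifP;
  rewrite ?mul0r.
Qed.

(* Conditioned on a leaf the blocks stay independent, so the correlation at the
   leaf is the product over the blocks of at most [M - h + a]: the part
   weighted by [1 - H] may be known exactly, the part weighted by [H]
   contributes [a], and these [a] add up to the leaf norms of the restricted
   trees. *)
Lemma xor_correlation_bound (f : cube 'I_n -> bool) (H : cube 'I_n -> R)
    (s : R) t m :
  (forall x, 0 <= H x <= 1) -> 0 < s -> (forall i x, 0 <= m i x) ->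
  \sum_X pweight m X * (-1) ^+ (xor_power f X (+) dtree_eval t X) <=
  expR s * \prod_i \sum_x m i x * (1 - H x / 2) +
  s^-1 * \sum_i \sum_z pweight (update m i mu) z *
     leaf_norm (restrict i z t) (fun x => m i x * H x * (-1) ^+ f x).
Proof.
move=> H01 s0; elim: t m => [b|p t0 IH0 t1 IH1] m m0 /=.
  pose M i := \sum_x m i x; pose h i := \sum_x m i x * H x.
  pose a i := `|\sum_x m i x * H x * (-1) ^+ f x|.
  have H0 x : 0 <= H x by case/andP: (H01 x).
  have H1 x : H x <= 1 by case/andP: (H01 x).
  have ah i : 0 <= a i <= h i.
    rewrite normr_ge0 /=; apply: (le_trans (ler_norm_sum _ _ _)).
    by apply: ler_sum => x _; rewrite normr_mul_sign ger0_norm // mulr_ge0.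
  have hM i : h i <= M i by apply: ler_sum => x _; rewrite ler_piMr.
  apply: le_trans (le_trans (prod_bound s0 ah hM) _); last first.
    rewrite lerD //.
      rewrite ler_wpM2l ?expR_ge0 // le_eqVlt; apply/orP; left; apply/eqP.
      apply: eq_bigr => i _; rewrite /M /h mulr_suml -sumrB.
      by apply: eq_bigr => x _; rewrite mulrBr mulr1 mulrA.
    rewrite ler_wpM2l ?invr_ge0 ?(ltW s0) // ler_sum // => i _.
    by rewrite -mulr_suml sum_pweight_update mu1 mul1r mulrC.
  under eq_bigr => X _.
    rewrite signr_addb signr_xor_power mulrA /pweight -big_split /=; over.
  rewrite -mulr_suml (sum_pweight (fun i x => m i x * (-1) ^+ f x)).
  apply: (le_trans (ler_norm _)); rewrite normr_mul_sign normr_prod.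
  apply: ler_prod => i _; rewrite normr_ge0 /=.
  (* The part weighted by [1 - H] is bounded by its mass [M i - h i], the part weighted by [H] is
     [a i] in absolute value. *)
  rewrite (_ : \sum_x _ = \sum_x m i x * (1 - H x) * (-1) ^+ f x +
     \sum_x m i x * H x * (-1) ^+ f x); last first.
    by rewrite -big_split; apply: eq_bigr => x _; rewrite /=; ring.
  apply: (le_trans (ler_normD _ _)); rewrite lerD //.
  apply: (le_trans (ler_norm_sum _ _ _)).
  rewrite /M /h -sumrB ler_sum // => x _.
  by rewrite normr_mul_sign ger0_norm ?mulr_ge0 ?subr_ge0 // mulrBr mulr1.
have m0b b : forall i x, 0 <= branch m p b i x by exact: branch_ge0.
rewrite (sum_branch _ p).
(* The weight of a branch vanishes unless [X p] is the answer taken, so the subtree can replace the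
   conditional. *)
have E (b : bool) :
    \sum_X pweight (branch m p b) X *
      (-1) ^+ (xor_power f X (+) dtree_eval (if b then t1 else t0) X) =
    \sum_X pweight (branch m p b) X * (-1) ^+ (xor_power f X (+)
       (if X p then dtree_eval t1 X else dtree_eval t0 X)).
  apply: eq_bigr => X _; rewrite pweight_branch; case: ifP => [/eqP ->|_].
    by case: b.
  by rewrite !mul0r.
rewrite -(E false) -(E true) /=.
apply: (le_trans (lerD (IH0 _ (m0b false)) (IH1 _ (m0b true)))).
rewrite addrACA -mulrDr -(branch_prod m p (fun i x => 1 - H x / 2)).
rewrite lerD // -mulrDr ler_wpM2l ?invr_ge0 ?(ltW s0) // -big_split /=.
rewrite ler_sum // => i _.
(* In the queried block the restricted tree branches as well, and its two leaf norms add up for each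
   [z]. In any other block it is [z] that selects the subtree, so the sum over [z] splits
   instead. *)
have [<-|pi] := eqVneq p.1 i.
  rewrite !update_branch -big_split /= ler_sum // => z _.
  rewrite -mulrDr /= !branch_eq.
  suff C b : (fun x => halve p.2 b (m p.1) x * H x * (-1) ^+ f x) =
     halve p.2 b (fun x => m p.1 x * H x * (-1) ^+ f x) by rewrite !C.
  by apply: funext => x; rewrite /halve; case: ifP; rewrite ?mul0r.
rewrite !branch_neq // [X in _ <= X](sum_branch _ p) !update_branchC //.
rewrite lerD // le_eqVlt; apply/orP; left; apply/eqP; apply: eq_bigr => z _;
  by rewrite pweight_branch; case: ifP => [/eqP ->|_]; rewrite ?mul0r.
Qed.

(** Each query of [t] concerns exactly one block and is made by the restriction to that block alone,
    where [x] stands for the block left out of [z]. *)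
Lemma sum_restrict_queries t m :
  \sum_i \sum_z pweight (update m i mu) z *
     \sum_x m i x * (dtree_queries (restrict i z t) x)%:R =
  \sum_X pweight m X * (dtree_queries t X)%:R.
Proof.
elim: t m => [b|p t0 IH0 t1 IH1] m /=.
  rewrite [RHS]big1 => [|X _]; last by rewrite mulr0.
  rewrite big1 // => i _; rewrite big1 // => z _.
  by rewrite big1 ?mulr0 // => x _; rewrite mulr0.
have -> : \sum_X pweight m X *
     ((if X p then dtree_queries t1 X else dtree_queries t0 X).+1)%:R =
   \prod_i \sum_x m i x +
   (\sum_X pweight (branch m p false) X * (dtree_queries t0 X)%:R +
    \sum_X pweight (branch m p true) X * (dtree_queries t1 X)%:R).
  rewrite -sum_pweight -!big_split /=; apply: eq_bigr => X _.
  rewrite !pweight_branch -natr1 mulrDr mulr1 addrC.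
  by case: (X p); rewrite /= mul0r ?addr0 ?add0r.
rewrite -IH0 -IH1 -big_split /=.
rewrite [X in _ = _ + X](bigD1 p.1) //= [LHS](bigD1 p.1) //= addrA.
congr (_ + _).
  (* The root query costs the total mass of [m]; all of it is charged to block [p.1]. *)
  have prodE : \prod_i \sum_x m i x =
      \sum_z pweight (update m p.1 mu) z * \sum_x m p.1 x.
    by rewrite -mulr_suml sum_pweight_update mu1 mul1r mulrC [LHS](bigD1 p.1).
  rewrite eqxx !update_branch !branch_eq prodE -!big_split /=.
  apply: eq_bigr => z _; rewrite -!mulrDr -!big_split /=; congr (_ * _).
  apply: eq_bigr => x _; rewrite /halve.
  by case: (x p.2); rewrite /= mul0r ?addr0 ?add0r -natr1 mulrDr mulr1 addrC.
apply: eq_bigr => i ip /=.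
have pi : p.1 != i by rewrite eq_sym.
rewrite (negbTE pi) !branch_neq // !update_branchC // (sum_branch _ p).
by congr (_ + _); apply: eq_bigr => z _;
  rewrite pweight_branch; case: ifP => [/eqP ->|_]; rewrite ?mul0r.
Qed.


End Blocks.

(** * Selecting a maximal violator, and selecting by averaging *)

(* A maximal violator: if [D] were negative at some [w] vanishing on [H = 1],
   then [H] plus the largest multiple of [w] that stays below [1] would be a
   further violator, with more ones than [H]. *)
Lemma maximal_violator (R : realFieldType) (T : finType) (D : (T -> R) -> R) :
  (forall g h, D (fun x => g x + h x) <= D g + D h) ->
  (forall c g, 0 <= c -> D (fun x => c * g x) = c * D g) ->
  exists H : T -> R, [/\ forall x, 0 <= H x <= 1, D H <= 0 &
    forall w, (forall x, 0 <= w x) -> (forall x, H x = 1 -> w x = 0) ->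
      0 <= D w].
Proof.
move=> DD DZ; pose ones (H : T -> R) := #|[pred x | H x == 1]|.
pose P (j : nat) := `[< exists H : T -> R,
  [/\ forall x, 0 <= H x <= 1, D H <= 0 & ones H = j] >].
have D0 : D (fun=> 0) = 0.
  rewrite -[RHS](mul0r (D (fun=> 0))) -DZ //; congr D.
  by apply: funext => x; rewrite mul0r.
have Pex : exists j, P j.
  exists (ones (fun=> 0)); apply/asboolP; exists (fun=> 0).
  by split=> [x||//]; rewrite ?D0 ?lexx ?ler01.
have Pb j : P j -> (j <= #|T|)%N.
  by move/asboolP => [H [_ _ <-]]; exact: max_card.
case: (ex_maxnP Pex Pb) => j /asboolP[H [H01 DH <-]] Hmax.
exists H; split=> // w w0 wH; rewrite leNgt; apply/negP => Dw.
have [x1 x1P] : exists x, 0 < w x.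
  apply: contrapT => /forallNP wN; move: Dw; rewrite -[w](_ : (fun=> 0) = w).
    by rewrite D0 ltxx.
  by apply: funext => x; apply/eqP; rewrite eq_le w0 leNgt; apply/negP/wN.
(* The constraint [H + t * w <= 1] first becomes tight at a minimiser [x0] of this ratio over the
   support of [w]; [x0] is the new one. *)
case: (@arg_minP _ _ T x1 (fun x => 0 < w x) (fun x => (1 - H x) / w x) x1P)
  => x0 wx0 x0min.
set t := (1 - H x0) / w x0 in x0min.
have t0 : 0 <= t by rewrite divr_ge0 // subr_ge0; case/andP: (H01 x0).
suff : (ones (fun x => (H x + t * w x)%R) <= ones H)%N.
  rewrite leqNgt => /negP; apply; apply: proper_card; apply/properP; split.
    apply/fintype.subsetP => x; rewrite !inE => /eqP Hx.
    by rewrite (wH _ Hx) mulr0 addr0 Hx.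
  exists x0; rewrite !inE.
    by rewrite /t divfK ?(gt_eqF wx0) // addrC subrK.
  by apply/eqP => /wH wx; move: wx0; rewrite wx ltxx.
apply: Hmax; apply/asboolP; exists (fun x => H x + t * w x); split=> // [x|].
  case/andP: (H01 x) => Hx0 Hx1; rewrite addr_ge0 ?(mulr_ge0 t0 (w0 x)) //=.
  have [wx|wx] := ltP 0 (w x).
    by move: (x0min x wx); rewrite ler_pdivlMr // => ?; rewrite addrC -lerBrDr.
  have -> : w x = 0 by apply/eqP; rewrite eq_le wx w0.
  by rewrite mulr0 addr0.
apply: (le_trans (DD H (fun x => t * w x))); rewrite DZ //.
by rewrite -[X in _ <= X]addr0 lerD // mulr_ge0_le0 // ltW.
Qed.

Lemma exists_le_average (R : realFieldType) (A : finType) (q v : A -> R)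
    (V : R) :
  (forall a, 0 <= q a) -> \sum_a q a = 1 -> \sum_a q a * v a <= V ->
  exists a, v a <= V.
Proof.
move=> q0 q1 vV; apply: contrapT => /forallNP vN.
have vP a : V < v a by rewrite ltNge; apply/negP/vN.
have : \sum_a q a * (v a - V) <= 0.
  under eq_bigr => a _ do rewrite mulrBr.
  by rewrite sumrB -mulr_suml q1 mul1r subr_le0.
have p0 a : 0 <= q a * (v a - V) by rewrite mulr_ge0 // subr_ge0 ltW.
rewrite le_eqVlt ltNge sumr_ge0 // orbF psumr_eq0 // => /allP qN.
move: q1; rewrite big1 => [/eqP|a _]; first by rewrite eq_sym oner_eq0.
have := qN a (mem_index_enum a); rewrite mulf_eq0 => /orP[/eqP //|].
by rewrite gt_eqF // subr_gt0.
Qed.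

(** * Majority vote of a sequence of trees *)

Section Majority.
Variable I : finType.
Implicit Types (t : dtree I) (ts : seq (dtree I)).

Fixpoint bind t (next : bool -> dtree I) : dtree I :=
  match t with
  | Leaf b => next b
  | Query i t0 t1 => Query i (bind t0 next) (bind t1 next)
  end.

Fixpoint majority (q : nat) ts (votes : nat) : dtree I :=
  if ts is t :: ts' then bind t (fun b => majority q ts' (b + votes))
  else Leaf (q < votes)%N.

Lemma bind_eval t next x :
  dtree_eval (bind t next) x = dtree_eval (next (dtree_eval t x)) x.
Proof. by elim: t => //= i t0 IH0 t1 IH1; case: (x i). Qed.

Lemma bind_queries t next x :
  dtree_queries (bind t next) x =
  (dtree_queries t x + dtree_queries (next (dtree_eval t x)) x)%N.
Proof. by elim: t => //= i t0 IH0 t1 IH1; case: (x i); rewrite ?IH0 ?IH1. Qed.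

Lemma majority_eval q ts votes x :
  dtree_eval (majority q ts votes) x =
  (q < count (fun t => dtree_eval t x) ts + votes)%N.
Proof.
elim: ts votes => //= t ts IH votes.
by rewrite bind_eval IH addnCA addnA.
Qed.

Lemma majority_queries q ts votes x :
  dtree_queries (majority q ts votes) x = (\sum_(t <- ts) dtree_queries t x)%N.
Proof.
elim: ts votes => [|t ts IH] votes /=; first by rewrite big_nil.
by rewrite bind_queries IH big_cons.
Qed.

Variables (R : realType) (eta : R).
Hypothesis eta01 : 0 < eta < 1.

(** A wrong majority of [2 q] votes has at most [q] right ones. A right vote contributes [1 - eta]
    and a wrong one [1 + eta]: each right vote pairs with a wrong one into [1 - eta ^+ 2], and the
    wrong votes left over contribute at least 1. *)
Lemma majority_penalty q ts x (b : bool) : size ts = q.*2 ->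
  dtree_eval (majority q ts 0) x != b ->
  (1 - eta ^+ 2) ^+ q <=
  \prod_(t <- ts) (1 - eta * (-1) ^+ (b (+) dtree_eval t x)).
Proof.
move=> ts2; rewrite majority_eval addn0 => wrong.
case/andP: eta01 => e0 e1.
pose right := count (fun t => dtree_eval t x == b) ts.
have penaltyE : \prod_(t <- ts) (1 - eta * (-1) ^+ (b (+) dtree_eval t x)) =
    (1 - eta) ^+ right * (1 + eta) ^+ (q.*2 - right).
  rewrite -ts2 {}/right {wrong}; elim: (ts) => [|t l IH] /=.
    by rewrite big_nil !expr0 mulr1.
  rewrite big_cons {}IH; have cl := count_size (fun t => dtree_eval t x == b) l.
  case: b (dtree_eval t x) cl => [] [] cl /=;
    rewrite ?add0n ?add1n ?subSS ?subSn // ?expr0 ?expr1 exprS; ring.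
have rightq : (right <= q)%N.
  move: wrong (count_predC (fun t => dtree_eval t x) ts).
  rewrite ts2 {penaltyE}/right; case: b.
    rewrite (@eq_count _ (fun t => dtree_eval t x == true)
      (fun u => dtree_eval u x)).
      by rewrite eqb_id -leqNgt.
    by move=> t /=; rewrite eqb_id.
  rewrite (@eq_count _ (fun t => dtree_eval t x == false)
    (predC (fun u => dtree_eval u x))); last by move=> t /=; rewrite eqbF_neg.
  rewrite eqbF_neg negbK -addnn => lt E.
  by rewrite -(leq_add2l q) -E leq_add2r ltnW.
rewrite penaltyE (_ : q.*2 - right = right + (q - right).*2)%N; last first.
  by rewrite doubleB -addnn -addnn; move: rightq; lia.
rewrite exprD mulrA -exprMn.
rewrite (_ : (1 - eta) * (1 + eta) = 1 - eta ^+ 2); last ring.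
have p0 : 0 <= 1 - eta ^+ 2 by rewrite expr2; nra.
have p1 : 1 - eta ^+ 2 <= 1 by rewrite lerBlDr lerDl sqr_ge0.
rewrite -{1}(subnKC rightq) exprD ler_wpM2l ?exprn_ge0 //.
apply: (@le_trans _ _ 1); first by rewrite exprn_ile1.
by rewrite exprn_ege1 // lerDl ltW.
Qed.

End Majority.

(** * Boosting with trees drawn from a fixed distribution *)

Section Boosting.
Variables (R : realType) (I : finType) (mu : cube I -> R) (f : cube I -> bool).
Hypothesis mu_dist : is_distribution mu.
Variables (A : finType) (q : A -> R) (s : A -> dtree I).
Hypotheses (q_ge0 : forall a, 0 <= q a) (q1 : \sum_a q a = 1).

Definition mean_leaf_norm (w : cube I -> R) : R :=
  \sum_a q a * leaf_norm (s a) (fun x => mu x * w x * (-1) ^+ f x).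

Definition mean_weight (w : cube I -> R) : R := \sum_x mu x * w x.

Let mu_ge0 x : 0 <= mu x. Proof. by case: mu_dist. Qed.

Lemma mean_leaf_normD g h :
  mean_leaf_norm (fun x => g x + h x) <= mean_leaf_norm g + mean_leaf_norm h.
Proof.
rewrite /mean_leaf_norm -big_split ler_sum // => a _ /=.
rewrite -mulrDr ler_wpM2l // (le_trans _ (leaf_normD _ _ _)) // le_eqVlt.
apply/orP; left; apply/eqP; congr leaf_norm; apply: funext => x; ring.
Qed.

Lemma mean_leaf_normZ c g : 0 <= c ->
  mean_leaf_norm (fun x => c * g x) = c * mean_leaf_norm g.
Proof.
move=> c0; rewrite /mean_leaf_norm mulr_sumr; apply: eq_bigr => a _.
rewrite mulrCA -(leaf_normZ _ _ c0); congr (_ * _); congr leaf_norm.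
by apply: funext => x; ring.
Qed.

Variables (eta d : R) (G : pred (cube I)).
Hypotheses (eta01 : 0 < eta < 1) (d0 : 0 < d).
Hypothesis depth_le : \sum_a q a * tree_depth mu (s a) <= d.
(** Weak learning on [G]: the law [q] of the trees is the same for every [w], and only the leaf
    labels adapt to it. *)
Hypothesis weak : forall w, (forall x, 0 <= w x) ->
  (forall x, ~~ G x -> w x = 0) ->
  eta * mean_weight w <= mean_leaf_norm w.

(** Multiplicative weights with factors affine in the sign, so that adding a relabelled tree lowers
    the total penalty on [G] by exactly [eta] times a leaf norm. *)
Definition penalty (ts : seq (dtree I)) x : R :=
  \prod_(t <- ts) (1 - eta * (-1) ^+ (f x (+) dtree_eval t x)).

Let e2 : 0 < 1 - eta ^+ 2.
Proof. by case/andP: eta01 => e0 e1; rewrite expr2; nra. Qed.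

Lemma penalty_ge0 ts x : 0 <= penalty ts x.
Proof.
apply: prodr_ge0 => t _; case/andP: eta01 => e0 e1.
by case: addb; rewrite ?expr0 ?expr1; lra.
Qed.

(* Normalised so that the expected increase of the potential, when a tree is
   drawn from [q] and relabelled optimally against the current penalties, is at
   most [1 / r]. *)
Lemma boosting (r j : nat) : (0 < r)%N ->
  exists ts : seq (dtree I), size ts = j /\
    (\sum_(x | G x) mu x * penalty ts x) / (1 - eta ^+ 2) ^+ j +
    (\sum_(t <- ts) tree_depth mu t) / (r%:R * d) <= 1 + j%:R / r%:R.
Proof.
move=> r0; have rR : 0 < r%:R :> R by rewrite ltr0n.
elim: j => [|j [ts [tsj IH]]].
  exists [::]; split=> //; rewrite big_nil mul0r !addr0 expr0 divr1 mul0r addr0.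
  under eq_bigr => x _ do rewrite /penalty big_nil mulr1.
  case: mu_dist => _ <-; rewrite [leRHS](bigID G) /= lerDl.
  by rewrite sumr_ge0.
pose w x := if G x then penalty ts x else 0.
have w0 x : 0 <= w x by rewrite /w; case: ifP => // _; exact: penalty_ge0.
pose g x := mu x * w x * (-1) ^+ f x.
pose new a := relabel (s a) g.
have EwE : \sum_(x | G x) mu x * penalty ts x = mean_weight w.
  rewrite /mean_weight big_mkcond; apply: eq_bigr => x _.
  by rewrite /w; case: ifP; rewrite ?mulr0.
rewrite EwE in IH.
have pnew a : \sum_(x | G x) mu x * penalty (new a :: ts) x =
    mean_weight w - eta * leaf_norm (s a) g.
  rewrite -relabel_correlation mulr_sumr -sumrB big_mkcond.
  apply: eq_bigr => x _; rewrite /penalty big_cons -/(penalty ts x) /g /w.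
  case: ifP => _; last by rewrite !(mulr0, mul0r) subr0.
  by rewrite signr_addb; ring.
have dnew a : tree_depth mu (new a) = tree_depth mu (s a).
  by apply: eq_bigr => x _; rewrite relabel_queries.
have ws := weak w0; have {}ws : eta * mean_weight w <= mean_leaf_norm w.
  by apply: ws => x; rewrite /w => /negbTE ->.
pose c := ((1 - eta ^+ 2) ^+ j.+1)^-1.
have c0 : 0 <= c by rewrite invr_ge0 exprn_ge0 // ltW.
(* The potential after adding [new a], up to the depth already spent. Choosing [a] no worse than
   average for this sum controls penalty and depth together. *)
pose v a := (mean_weight w - eta * leaf_norm (s a) g) * c +
  tree_depth mu (s a) / (r%:R * d).
have [|a va] := @exists_le_average R A q v
  (mean_weight w / (1 - eta ^+ 2) ^+ j + r%:R^-1) q_ge0 q1.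
  have -> : \sum_a q a * v a = (mean_weight w - eta * mean_leaf_norm w) * c +
      (\sum_a q a * tree_depth mu (s a)) / (r%:R * d).
    rewrite /v; under eq_bigr => a _ do rewrite mulrDr !mulrA.
    rewrite big_split /= -!mulr_suml; congr (_ * _ + _).
    under eq_bigr => a _ do rewrite mulrBr.
    rewrite sumrB -mulr_suml q1 mul1r; congr (_ - _).
    by rewrite mulr_sumr; apply: eq_bigr => a _; rewrite mulrCA.
  apply: lerD; last first.
    by rewrite ler_pdivrMr ?mulr_gt0 // mulrA mulVf ?gt_eqF // mul1r.
  (* By [weak] the mean loss of penalty is at least [eta ^+ 2 * mean_weight w], which the
     normalisation [c] compensates. *)
  apply: (@le_trans _ _ (mean_weight w * (1 - eta ^+ 2) * c)).
    rewrite ler_wpM2r // mulrBr mulr1 lerB //.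
    case/andP: eta01 => e0 _; rewrite expr2 mulrCA ler_wpM2l ?(ltW e0) //.
    by rewrite mulrC.
  by rewrite /c (exprSr _ j) invfM mulrACA mulfV ?gt_eqF // mulr1.
exists (new a :: ts); split; first by rewrite /= tsj.
rewrite big_cons pnew dnew -/c [X in _ + X]mulrDl addrA.
apply: (le_trans (lerD va (lexx _))).
rewrite addrAC -[j.+1%:R]natr1 [in leRHS]mulrDl mul1r addrA lerD2r.
exact: IH.
Qed.

(** Taking [2 j] trees and [r = 2 j] keeps the potential at most 2. The penalties on [G] then total
    at most [2 * (1 - eta ^+ 2) ^+ (2 j)], while each error costs [(1 - eta ^+ 2) ^+ j], so Markov's
    inequality bounds the error on [G]; points outside [G] are given up. *)
Lemma boosted_majority (j : nat) : (0 < j)%N ->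
  exists t : dtree I,
    tree_error mu f t <= \sum_(x | ~~ G x) mu x + 2 * (1 - eta ^+ 2) ^+ j /\
    tree_depth mu t <= 4 * j%:R * d.
Proof.
move=> j0; have r0 : (0 < j.*2)%N by rewrite double_gt0.
have rR : 0 < j.*2%:R :> R by rewrite ltr0n.
have [ts [tsj]] := boosting j.*2 r0.
rewrite mulfV ?gt_eqF // => W.
have P0 : 0 <= \sum_(x | G x) mu x * penalty ts x.
  by rewrite sumr_ge0 // => x _; rewrite mulr_ge0 // penalty_ge0.
have T0 : 0 <= \sum_(t <- ts) tree_depth mu t.
  by rewrite sumr_ge0 // => t _; rewrite sumr_ge0 // => x _; rewrite mulr_ge0.
exists (majority j ts 0); split.
  rewrite /tree_error (bigID (fun x => ~~ G x)) /= lerD //.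
    rewrite [leRHS](bigID (fun x => dtree_eval (majority j ts 0) x != f x)) /=.
    rewrite (eq_bigl _ _ (fun x => andbC _ _)) lerDl.
    by rewrite sumr_ge0.
  have PW : \sum_(x | G x) mu x * penalty ts x <= 2 * (1 - eta ^+ 2) ^+ j.*2.
    rewrite -ler_pdivrMr ?exprn_gt0 //.
    apply: le_trans (le_trans W _); last by lra.
    by rewrite lerDl divr_ge0 // mulr_ge0 // ltW.
  rewrite -(ler_pM2r (exprn_gt0 j e2)) -mulrA -exprD addnn.
  apply: le_trans PW; rewrite mulr_suml [leRHS]big_mkcond [leLHS]big_mkcond.
  apply: ler_sum => x _; rewrite negbK.
  case: (G x); last by rewrite andbF.
  rewrite andbT; case: ifP => [wrong|_]; last first.
    by rewrite mulr_ge0 // penalty_ge0.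
  by rewrite ler_wpM2l // majority_penalty.
have -> : tree_depth mu (majority j ts 0) = \sum_(t <- ts) tree_depth mu t.
  rewrite /tree_depth exchange_big /=; apply: eq_bigr => x _.
  by rewrite majority_queries natr_sum mulr_sumr.
have : (\sum_(t <- ts) tree_depth mu t) / (j.*2%:R * d) <= 2.
  apply: le_trans (le_trans W _); last by lra.
  by rewrite lerDr divr_ge0 // exprn_ge0 // ltW.
rewrite ler_pdivrMr ?mulr_gt0 // => /le_trans; apply.
by rewrite -mul2n natrM; lra.
Qed.

End Boosting.

(** Trees are countable, so finitely many carry mass at least [1 - eta]; the remaining mass moves to
    a leaf, which makes no query. Expectations become finite sums. *)
Lemma finite_mixture (R : realType) (I : finType)
    (P : probability (dtree I) R) (eta : R) : 0 < eta ->
  exists (N : nat) (p : 'I_N -> R) (t : 'I_N -> dtree I),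
    [/\ forall j, 0 <= p j, \sum_j p j = 1 &
      forall phi : dtree I -> R, (forall u, 0 <= phi u) ->
        ((\sum_j p j * phi (t j))%:E <=
         'E_P[phi] + (eta * phi (Leaf false))%:E)%E].
Proof.
move=> eta0.
pose B (j : nat) : set (dtree I) := [set u | pickle u = j]%classic.
pose F (N : nat) : set (dtree I) := [set u | (pickle u < N)%N]%classic.
have FE N : F N = \big[setU/set0]_(j < N) B j.
  apply/seteqP; split=> u /=.
    by move=> uN; rewrite -bigcup_mkord; exists (pickle u).
  by rewrite -bigcup_mkord => -[j /= jN uj]; rewrite /F /= uj.
have tB : trivIset setT B.
  by move=> i j _ _ [u [/= ui uj]]; rewrite -ui -uj.
have PF N : P (F N) = (\sum_(j < N) P (B j))%E by rewrite FE measure_bigsetU.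
have [N HN] : exists N, ((1 - eta)%:E <= P (F N))%E.
  have ndF : {homo F : i j / (i <= j)%N >-> (i <= j)%O}.
    by move=> i j ij; rewrite subsetEset => u /= /leq_trans; apply.
  have cvgF : (P \o F @ \oo --> 1%E)%classic.
    rewrite -(@probability_setT _ _ _ P).
    rewrite (_ : setT = \bigcup_j F j)%classic; last first.
      by apply/seteqP; split=> // u _; exists (pickle u).+1; rewrite // /F /=.
    exact: nondecreasing_cvg_mu.
  have ndP : nondecreasing_seq (P \o F).
    by move=> i j ij /=; rewrite le_measure ?inE //; rewrite -subsetEset ndF.
  have cP : cvgn (P \o F) by apply: cvgP cvgF.
  have /(lte_lim ndP cP) [N _ HN] : ((1 - eta)%:E < limn (P \o F))%E.
    by rewrite (cvg_lim _ cvgF) // lte_fin ltrBlDr ltrDl.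
  by exists N; apply: HN => /=.
have fB j : P (B j) \is a fin_num by exact: fin_num_measure.
pose pB (j : nat) := fine (P (B j)).
have pB0 j : 0 <= pB j by exact: fine_ge0.
have pBE : P (F N) = (\sum_(j < N) pB j)%:E.
  by rewrite PF -sumEFin; apply: eq_bigr => j _; rewrite fineK.
have pB1 : \sum_(j < N) pB j <= 1 by rewrite -lee_fin -pBE probability_le1.
(* The last atom takes the missing mass. A number below [N] that codes no tree has mass 0, so its
   default tree is harmless. *)
exists N.+1, (fun j => if (j < N)%N then pB j else 1 - \sum_(i < N) pB i),
  (fun j => if (j < N)%N then odflt (Leaf false) (unpickle j) else Leaf false).
split.
- by move=> j; case: ifP => // _; rewrite subr_ge0.
- rewrite big_ord_recr /= ltnn.
  by under eq_bigr => j _ do rewrite ltn_ord; rewrite addrC subrK.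
move=> phi phi0; rewrite big_ord_recr /= ltnn EFinD leeD //; last first.
  by rewrite lee_fin ler_wpM2r // lerBlDr addrC -lerBlDr -lee_fin -pBE.
under eq_bigr => j _ do rewrite ltn_ord.
apply: (@le_trans _ _ (\int[P]_(u in F N) (phi u)%:E)%E); last first.
  rewrite expectation.unlock.
  apply: (@ge0_subset_integral _ _ _ P (F N) setT) => //.
  by move=> u _; rewrite lee_fin.
rewrite FE -(big_mkord xpredT B) ge0_integral_bigsetU //; last 3 first.
- exact: iota_uniq.
- exact: sub_trivIset tB.
- by move=> u _; rewrite lee_fin.
rewrite big_mkord -sumEFin le_eqVlt; apply/orP; left; apply/eqP.
apply: eq_bigr => j _.
rewrite (@eq_integral _ _ _ _ _
  (cst (phi (odflt (Leaf false) (unpickle j)))%:E)).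
  by rewrite integral_cst // EFinM /pB fineK // muleC.
by move=> u; rewrite inE => <-; rewrite pickleK.
Qed.

Lemma sum_sign_xor (R : realType) (I : finType) (mu : cube I -> R)
    (g : cube I -> bool) (t : dtree I) : \sum_x mu x = 1 ->
  \sum_x mu x * (-1) ^+ (g x (+) dtree_eval t x) = 1 - 2 * tree_error mu g t.
Proof.
move=> mu1; rewrite -[X in X - _]mu1 /tree_error [X in _ * X]big_mkcond.
rewrite mulr_sumr -sumrB.
apply: eq_bigr => x _; rewrite eq_sym.
by case: (g x); case: (dtree_eval t x); rewrite /= ?expr0 ?expr1; ring.
Qed.

(** * From a mixture for the XOR to a tree for one block *)

Section SingleBlock.
Variables (R : realType) (n k : nat) (f : cube 'I_n -> bool).
Variable mu : cube 'I_n -> R.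
Hypotheses (mu_dist : is_distribution mu) (k_gt0 : (0 < k)%N).
Variables (N : nat) (p : 'I_N -> R) (t : 'I_N -> dtree ('I_k * 'I_n)%type).
Hypotheses (p_ge0 : forall j, 0 <= p j) (p1 : \sum_j p j = 1).

Let mu_ge0 x : 0 <= mu x. Proof. by case: mu_dist. Qed.
Let mu1 : \sum_x mu x = 1. Proof. by case: mu_dist. Qed.
Let kR : 0 < k%:R :> R. Proof. by rewrite ltr0n. Qed.

Notation muk := (power_distribution (k := k) mu).
Notation index := ('I_N * 'I_k * cube ('I_k * 'I_n)%type)%type.

(** A tree of the mixture, a uniform block and a random input for the other blocks, drawn
    independently. *)
Definition single_weight (a : index) : R := p a.1.1 * (k%:R^-1 * muk a.2).

Definition single_tree (a : index) : dtree 'I_n :=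
  restrict a.1.2 a.2 (t a.1.1).

Lemma sum_single (F : dtree 'I_n -> R) :
  \sum_a single_weight a * F (single_tree a) =
  \sum_j p j * (k%:R^-1 * \sum_i \sum_z muk z * F (restrict i z (t j))).
Proof.
rewrite -(pair_bigA _ (fun b z =>
  single_weight (b, z) * F (single_tree (b, z)))).
rewrite -(pair_bigA _ (fun j i => \sum_z single_weight (j, i, z) *
  F (single_tree (j, i, z)))) /=.
apply: eq_bigr => j _; rewrite !mulr_sumr; apply: eq_bigr => i _.
rewrite !mulr_sumr; apply: eq_bigr => z _.
by rewrite /single_weight /single_tree /= !mulrA.
Qed.

Lemma update_const (i : 'I_k) : update (fun=> mu) i mu = fun=> mu.
Proof. by apply: funext => j; rewrite /update; case: ifP. Qed.

Lemma single_weight_ge0 a : 0 <= single_weight a.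
Proof.
have [muk0 _] := power_distribution_is_distribution k mu_dist.
by rewrite !mulr_ge0 ?invr_ge0 ?(ltW kR) ?muk0.
Qed.

Lemma sum_power_distribution : \sum_X muk X = 1.
Proof. by case: (power_distribution_is_distribution k mu_dist). Qed.

Lemma sum_single_weight : \sum_a single_weight a = 1.
Proof.
rewrite -[RHS]p1 -(eq_bigr _ (fun a _ => mulr1 _)) (sum_single (fun=> 1)).
apply: eq_bigr => j _; rewrite -[RHS]mulr1; congr (_ * _).
under eq_bigr => i _ do rewrite -mulr_suml sum_power_distribution mulr1.
by rewrite sumr_const card_ord mulVf // gt_eqF.
Qed.

(** The restrictions to the [k] blocks share the queries of [t j], so a uniform block receives a
    fraction [1 / k] of the mean depth. *)
Lemma single_tree_depth :
  \sum_a single_weight a * tree_depth mu (single_tree a) =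
  (\sum_j p j * tree_depth muk (t j)) / k%:R.
Proof.
rewrite sum_single mulr_suml; apply: eq_bigr => j _.
rewrite -mulrA [X in _ = _ * X]mulrC; congr (_ * (_ * _)).
rewrite /tree_depth -[RHS](sum_restrict_queries mu1 (t j) (fun=> mu)).
by apply: eq_bigr => i _; rewrite update_const.
Qed.

Lemma xor_hardness (H : cube 'I_n -> R) (gamma delta : R) :
  (forall x, 0 <= H x <= 1) -> 0 < delta -> delta / 2 <= mean_weight mu H ->
  \sum_j p j * tree_error muk (@xor_power n k f) (t j) <=
    2^-1 * (1 - expR (- (8^-1 * delta * k%:R)) - gamma / 2) ->
  gamma / 8 * mean_weight mu H <=
  mean_leaf_norm mu f single_weight single_tree H.
Proof.
move=> H01 d0 dH err.
have H0 : 0 < mean_weight mu H by apply: lt_le_trans dH; rewrite divr_gt0.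
set h := mean_weight mu H in dH H0 *.
set B := mean_leaf_norm _ _ _ _ _.
(* This [s] makes the main term at most [exp (- h k / 4)], hence at most [exp (- delta k / 8)] as
   [h >= delta / 2]; this is the origin of [8^-1]. The other term becomes [4 B / h], which must
   cover the remaining [gamma / 2]. *)
pose s := h * k%:R / 4.
have s0 : 0 < s by rewrite divr_gt0 // mulr_gt0.
have adv : expR (- (8^-1 * delta * k%:R)) + gamma / 2 <=
    \sum_j p j * \sum_X muk X * (-1) ^+ (xor_power f X (+) dtree_eval (t j) X).
  under eq_bigr => j _ do
    rewrite sum_sign_xor ?sum_power_distribution // mulrBr mulr1 mulrCA.
  by rewrite sumrB p1 -mulr_sumr; move: err; lra.
have : \sum_j p j *
      \sum_X muk X * (-1) ^+ (xor_power f X (+) dtree_eval (t j) X) <=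
    expR s * (1 - h / 2) ^+ k + s^-1 * (k%:R * B).
  have -> : expR s * (1 - h / 2) ^+ k + s^-1 * (k%:R * B) =
     \sum_j p j * (expR s * (1 - h / 2) ^+ k + s^-1 * \sum_i \sum_z muk z *
       leaf_norm (restrict i z (t j)) (fun x => mu x * H x * (-1) ^+ f x)).
    under [RHS]eq_bigr => j _ do rewrite mulrDr.
    rewrite big_split /= -mulr_suml p1 mul1r; congr (_ + _).
    rewrite /B /mean_leaf_norm (sum_single (fun u => leaf_norm u _)).
    rewrite !mulr_sumr; apply: eq_bigr => j _.
    by rewrite [X in _ * X = _]mulrCA mulVKf ?(gt_eqF kR) // mulrCA.
  apply: ler_sum => j _; rewrite ler_wpM2l //.
  have := xor_correlation_bound mu1 f (m := fun=> mu) (t j) H01 s0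
    (fun=> mu_ge0).
  rewrite prodr_const card_ord.
  have -> : \sum_x mu x * (1 - H x / 2) = 1 - h / 2.
    rewrite -[X in _ = X - _]mu1 /h /mean_weight mulr_suml -sumrB.
    by apply: eq_bigr => x _; ring.
  move=> /le_trans; apply; rewrite lerD2l ler_wpM2l ?invr_ge0 ?(ltW s0) //.
  by apply: ler_sum => i _; rewrite update_const.
have small : expR s * (1 - h / 2) ^+ k <= expR (- (8^-1 * delta * k%:R)).
  have h1 : h <= 1.
    rewrite -mu1; apply: ler_sum => x _; rewrite ler_piMr //.
    by case/andP: (H01 x).
  apply: (@le_trans _ _ (expR s * expR (- (h / 2)) ^+ k)).
    rewrite ler_wpM2l ?expR_ge0 // lerXn2r ?nnegrE ?expR_ge0 //; first by lra.
    by rewrite -[1 - _]/(1 + _) expR_ge1Dx.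
  rewrite -expRM_natr -expRD ler_expR /s.
  have : delta / 2 * k%:R <= h * k%:R by rewrite ler_wpM2r // ltW.
  lra.
move=> up; have : gamma / 2 <= s^-1 * (k%:R * B) by move: adv up small; lra.
rewrite [leRHS]mulrC ler_pdivlMr // /s => lo.
suff : gamma / 8 * h * k%:R <= B * k%:R by rewrite ler_pM2r.
by move: lo; lra.
Qed.

Lemma single_block_tree (gamma delta D : R) :
  0 < gamma < 1 -> 0 < delta < 2^-1 -> 0 < D ->
  \sum_j p j * tree_error muk (@xor_power n k f) (t j) <=
    2^-1 * (1 - expR (- (8^-1 * delta * k%:R)) - gamma / 2) ->
  \sum_j p j * tree_depth muk (t j) <= D ->
  exists u : dtree 'I_n, tree_error mu f u <= delta /\
    tree_depth mu u <= 4096 * (ln delta^-1 / gamma ^+ 2) * (D / k%:R).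
Proof.
move=> /andP[g0 g1] /andP[d0 d2] D0 err dep.
(* Half the constant of [xor_hardness], so that a violator of weight at least [delta / 2] is
   contradictory. *)
pose eta := gamma / 16.
have eta01 : 0 < eta < 1 by apply/andP; split; rewrite /eta; lra.
pose B := mean_leaf_norm mu f single_weight single_tree.
have [g h|c g c0|H [H01 DH Hmax]] :=
  @maximal_violator R _ (fun w => B w - eta * mean_weight mu w).
- have := mean_leaf_normD mu f single_tree single_weight_ge0 g h.
  rewrite -/B (_ : mean_weight mu (fun x => g x + h x) =
    mean_weight mu g + mean_weight mu h).
    by lra.
  by rewrite /mean_weight -big_split; apply: eq_bigr => x _; rewrite /= mulrDr.
- rewrite /B mean_leaf_normZ //.
  rewrite (_ : mean_weight mu (fun x => c * g x) = c * mean_weight mu g).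
    by ring.
  by rewrite /mean_weight mulr_sumr; apply: eq_bigr => x _; rewrite mulrCA.
have Hsmall : mean_weight mu H < delta / 2.
  rewrite ltNge; apply/negP => dH.
  have := xor_hardness H01 d0 dH err; rewrite -/B => hard.
  have H0 : 0 < mean_weight mu H by apply: lt_le_trans dH; rewrite divr_gt0.
  have : 0 < gamma * mean_weight mu H by rewrite mulr_gt0.
  by move: DH hard; rewrite /eta; lra.
pose G : pred (cube 'I_n) := fun x => H x != 1.
have weak w : (forall x, 0 <= w x) -> (forall x, ~~ G x -> w x = 0) ->
    eta * mean_weight mu w <= mean_leaf_norm mu f single_weight single_tree w.
  move=> w0 wG; rewrite -subr_ge0; apply: Hmax => // x Hx.
  by apply: wG; rewrite /G Hx eqxx.
have GH : \sum_(x | ~~ G x) mu x <= mean_weight mu H.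
  rewrite /mean_weight [leRHS](bigID (fun x => ~~ G x)) /=.
  rewrite -[leLHS]addr0 lerD //.
    by apply: ler_sum => x; rewrite /G negbK => /eqP ->; rewrite mulr1.
  by rewrite sumr_ge0 // => x _; rewrite mulr_ge0 //; case/andP: (H01 x).
have Dk : 0 < D / k%:R by rewrite divr_gt0.
have depk : \sum_a single_weight a * tree_depth mu (single_tree a) <= D / k%:R.
  by rewrite single_tree_depth ler_wpM2r // invr_ge0 ltW.
pose L := ln delta^-1.
(* Uses [delta < 1/2]; it lets the rounding of [j] be absorbed at the end. *)
have L2 : 2^-1 <= L.
  rewrite /L lnV ?posrE //.
  have := @le_ln1Dx R (delta - 1); rewrite addrCA subrr addr0 => /(_ _); lra.
have e0 : 0 < eta ^+ 2 by rewrite exprn_gt0 //; case/andP: eta01.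
have e1 : eta ^+ 2 < 1.
  by rewrite expr_lt1 //; case/andP: eta01 => *; rewrite ?ltW.
(* Since [j > x], [(1 - eta ^+ 2) ^+ j <= delta / 4]; boosting then adds at most [delta / 2] to the
   error outside [G]. *)
pose x := ln (4 / delta) / eta ^+ 2.
have ln4 : 0 <= ln (4 / delta) <= 3 * L.
  have dV : 2 <= delta^-1.
    by rewrite -[leLHS]invrK lef_pV2 ?posrE ?invr_gt0 // ltW.
  rewrite ln_ge0; last by move: dV; lra.
  rewrite /L [leRHS]mulr_natl -lnXn ?invr_gt0 //.
  rewrite ler_ln ?posrE ?exprn_gt0 ?divr_gt0 ?invr_gt0 //=.
  rewrite exprS mulrC expr2 ler_pM2l ?invr_gt0 //; nra.
have x0 : 0 <= x by rewrite divr_ge0 ?(ltW e0) //; case/andP: ln4.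
have /andP[jx xj] := truncn_itv x0.
pose j := (Num.truncn x).+1.
have [u [uerr udep]] := boosted_majority mu_dist single_weight_ge0
  sum_single_weight eta01 Dk depk weak (ltn0Sn _ : (0 < j)%N).
exists u; split.
  apply: (le_trans uerr); suff : (1 - eta ^+ 2) ^+ j <= delta / 4.
    by move: GH Hsmall; lra.
  apply: (@le_trans _ _ (expR (- eta ^+ 2) ^+ j)).
    by rewrite lerXn2r ?nnegrE ?expR_ge0 ?expR_ge1Dx // subr_ge0 ltW.
  rewrite -expRM_natr -[leRHS]lnK ?posrE ?divr_gt0 // ler_expR.
  rewrite -[delta / 4]invf_div lnV ?posrE ?divr_gt0 // mulNr lerN2.
  by rewrite [leRHS]mulrC -ler_pdivrMr // ltW.
apply: (le_trans udep); rewrite ler_wpM2r ?(ltW Dk) //.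
(* Here [768 = 3 * 16 ^ 2] and [1 <= 2 L / gamma ^+ 2], so [4 j <= 3080 L / gamma ^+ 2], within the
   constant 4096. *)
have jle : j%:R <= x + 1 by rewrite /j -natr1 lerD2r.
have xle : x <= 768 * (L / gamma ^+ 2).
  rewrite /x /eta exprMn ler_pdivrMr ?mulr_gt0 ?exprn_gt0 //.
  case/andP: ln4 => _ /le_trans; apply.
  by rewrite [leRHS](_ : _ = 3 * L) //; field; rewrite gt_eqF.
have : 2^-1 <= L / gamma ^+ 2.
  rewrite ler_pdivlMr ?exprn_gt0 // (le_trans _ L2) // ler_piMr //.
  by rewrite expr_le1 // ltW.
rewrite -/L; lra.
Qed.

End SingleBlock.

(** * Passage to the infimum over randomized trees *)

Lemma avg_depth_le (R : realType) (I : finType) (mu : cube I -> R)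
    (g : cube I -> bool) (eps : R) (t : dtree I) :
  tree_error mu g t <= eps ->
  (avg_depth mu g eps <= (tree_depth mu t)%:E)%E.
Proof.
pose P : probability (dtree I) R := dirac t.
have dE (phi : dtree I -> R) : ('E_P[phi] = (phi t)%:E)%E.
  rewrite expectation.unlock integral_dirac //.
  by rewrite diracE in_setT mul1e.
move=> err; apply: ereal_inf_lbound; exists P => /=.
  by rewrite /rand_error dE lee_fin.
exact: dE.
Qed.

Theorem theorem4p2 (R : realType) :
  exists c1 c2 : R, 0 < c1 /\ 0 < c2 /\
    forall (n : nat) (f : cube 'I_n -> bool) (mu : cube 'I_n -> R),
      is_distribution mu ->
      forall (k : nat) (gamma delta : R),
        0 < gamma < 1 -> 0 < delta < 1 ->
        ((c2 * (gamma ^+ 2 * k%:R / ln (delta^-1)))%:E * avg_depth mu f delta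
         <= avg_depth (power_distribution mu) (@xor_power n k f)
              (2^-1 * (1 - expR (- (c1 * delta * k%:R)) - gamma)))%E.
Proof.
move eK : (4096 : R) => K; have K0 : 0 < K by rewrite -eK; lra.
exists 8^-1, K^-1; split; first by rewrite invr_gt0.
split; first by rewrite invr_gt0.
move=> n f mu mu_dist k gamma delta g01 /andP[d0 d1].
have [mu0 mu1] := mu_dist.
have [muk0 muk1] := power_distribution_is_distribution k mu_dist.
have depth0 u : 0 <= tree_depth (power_distribution (k := k) mu) u.
  by rewrite sumr_ge0 // => X _; rewrite mulr_ge0.
have L0 : 0 < ln delta^-1 by rewrite ln_gt0 // invf_gt1.
have g20 : 0 < gamma ^+ 2 by rewrite exprn_gt0 //; case/andP: g01.
set c := K^-1 * _.
have c0 : 0 <= c.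
  rewrite mulr_ge0 ?invr_ge0 ?(ltW K0) // divr_ge0 ?(ltW L0) //.
  by rewrite mulr_ge0 // ltW.
apply: le_ereal_inf_tmp => _ [P errP <-].
have P0 : (0 <= rand_depth (power_distribution mu) P)%E.
  exact: expectation_ge0.
have [k0|k0] := posnP k.
  have -> : c = 0 by rewrite /c k0 mulr0 mul0r mulr0.
  by rewrite mul0e.
(* For [delta >= 1/2] the better constant leaf already has error at most [delta], and the left-hand
   side is at most 0. *)
have [d2|d2] := leP 2^-1 delta.
  pose b := 2^-1 < tree_error mu f (Leaf false).
  have errb : tree_error mu f (Leaf b) <= delta.
    apply: le_trans d2; rewrite /b; case: ltP => // half.
    have := sum_sign_xor f (Leaf false) mu1.
    have := sum_sign_xor f (Leaf true) mu1.
    rewrite (eq_bigr (fun x =>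
      - (mu x * (-1) ^+ (f x (+) dtree_eval (Leaf false) x)))).
      by rewrite sumrN; lra.
    by move=> x _ /=; case: (f x); rewrite /= ?expr0 ?expr1; ring.
  apply: le_trans P0; rewrite mule_ge0_le0 //.
  apply: (le_trans (avg_depth_le errb)); rewrite lee_fin.
  by rewrite /tree_depth big1 // => x _; rewrite mulr0.
move: errP; rewrite /= => errP.
case DE : (rand_depth (power_distribution mu) P) P0 => [D||//] P0; last first.
  by rewrite leey.
(* The slack [e] makes the depth bound positive even when [D = 0]. *)
apply/lee_addgt0Pr => e e0; rewrite -EFinD.
(* Moving mass [gamma / 4] to a leaf raises the error by at most [gamma / 4], which turns [gamma]
   into [gamma / 2] inside the factor [2^-1], and adds no depth. *)
have g4 : 0 < gamma / 4 by rewrite divr_gt0 //; case/andP: g01.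
have [N [p [t [p0 p1 mix]]]] := finite_mixture P g4.
have D0 : 0 < D + e by rewrite ltr_wpDl // -lee_fin.
have [|//|||u [uerr udep]] := @single_block_tree R n k f mu mu_dist k0
  N p t p0 p1 gamma delta (D + e) g01.
- by rewrite d0.
- set err := tree_error (power_distribution mu) (@xor_power n k f).
  have := mix err.
  have le1 : err (Leaf false) <= 1.
    rewrite -muk1 /err /tree_error [leRHS](bigID (fun X =>
      dtree_eval (Leaf false) X != xor_power f X)) /=.
    by rewrite lerDl sumr_ge0.
  have err0 u : 0 <= err u by rewrite sumr_ge0.
  move=> /(_ err0) /le_trans - /(_ _ (leeD errP (lexx _))).
  rewrite -EFinD lee_fin => /le_trans; apply.
  have : gamma / 4 * err (Leaf false) <= gamma / 4 by rewrite ler_piMr // ltW.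
  lra.
- have := mix _ depth0; rewrite -/(rand_depth _ P) DE -EFinD lee_fin.
  rewrite (_ : tree_depth _ (Leaf false) = 0) ?mulr0 ?addr0; last first.
    by rewrite /tree_depth big1 // => x _; rewrite mulr0.
  by move=> /le_trans; apply; rewrite lerDl ltW.
apply: (le_trans (lee_wpmul2l _ (avg_depth_le uerr))); first by rewrite lee_fin.
rewrite -EFinM lee_fin.
rewrite eK in udep; apply: (le_trans (ler_wpM2l c0 udep)).
rewrite le_eqVlt; apply/orP; left; apply/eqP; rewrite /c; field.
by rewrite !gt_eqF ?ltr0n //; case/andP: g01.
Qed.
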